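(* Let the parameters $(x,y,\beta)$ satisfy $x>0$, $y>0$, $xy<1$, $\beta<0$. For any fixed $x,y$, there exists $\beta_0<0$ such that for all $\beta<\beta_0$, the frozen zone II (of the Schur process limit shape with parameters $(x,y,\beta)$) extends through the whole horizontal strip $\xi>0$, $0<\tau<1$ in the $(\xi,\tau)$ coordinates.
   Context: Parameters: $x>0$, $y>0$, $xy<1$, $\beta<0$. Schur process: for each $N$, the probability measure on $N$-tuples of partitions $(\mu^1,\ldots,\mu^N)$, each with at most $N$ parts, with weights proportional to $$s_{\mu^1}(\underbrace{x,\ldots,x}_N)\Bigl(\prod_{m=1}^{N-1}(-\beta)^{|\mu^m|-|\mu^{m+1}|}\prod_{j=1}^N\mathbf{1}_{\mu^m_j-\mu^{m+1}_j\in\{0,1\}}\Bigr)s_{\mu^N}(\underbrace{y,\ldots,y}_N),$$ with $s_\mu$ Schur polynomials. Set $x^t_j=\mu^t_j+N-j$ and $H_N(a,t)=\#\{j:x^t_j\ge a\}$ for $a\in\mathbb{Z}_{\ge0}$, $t=1,\ldots,N$. Limit shape: there is a continuous, piecewise differentiable function $\mathfrak{H}(\xi,\tau)$ on $[0,\infty)\times[0,1]$, weakly decreasing in both variables, such that $N^{-1}H_N(\lfloor\xi N\rfloor,\lfloor\tau N\rfloor)\to\mathfrak{H}(\xi,\tau)$ in probability as $N\to\infty$. Its gradient is described as follows. Consider the cubic equation in $z$ $$\xi xz^3-\bigl(\xi+\beta x(\xi+\tau-1)+(\xi+1)xy-1\bigr)z^2+\bigl(\beta(\xi+\tau+\xi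 xy+\tau xy-2)+\xi y\bigr)z-\beta y(\xi+\tau-1)=0.$$ The liquid region is the set of $(\xi,\tau)$ for which it has a pair of nonreal complex conjugate roots; there, with $z_c$ the root in the upper half-plane, $\partial_\xi\mathfrak{H}=-\frac1\pi\operatorname{Arg}z_c$ and $\partial_\tau\mathfrak{H}=\frac1\pi\bigl(\operatorname{Arg}(z_c-\beta)-\operatorname{Arg}z_c\bigr)$. The boundary of the liquid region (the frozen boundary) consists of points where the cubic has a real double root $z_c=\bar z_c$. Outside the liquid region are the frozen zones, where $\nabla\mathfrak{H}=(\partial_\xi\mathfrak{H},\partial_\tau\mathfrak{H})$ equals $(0,0)$ (zones Ia, Ib; adjacent frozen boundary has double root $z_c>0$), $(-1,-1)$ (zone II; adjacent frozen boundary has double root $\beta<z_c<0$), or $(-1,0)$ (zone III; adjacent frozen boundary has double root $z_c<\beta$). Thus zone II is the frozen zone where $\nabla\mathfrak{H}=(-1,-1)$. *)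

(* Defs.v *)
From HB Require Import structures.
From mathcomp Require Import all_boot all_order all_algebra.
From mathcomp Require Import all_classical all_reals all_analysis.
From mathcomp Require Import complex.

Set Implicit Arguments.
Unset Strict Implicit.
Unset Printing Implicit Defensive.

Import Order.TTheory GRing.Theory Num.Theory.
Import numFieldNormedType.Exports.
Import Normc.

Local Open Scope classical_set_scope.
Local Open Scope ring_scope.
Local Open Scope complex_scope.

Section Schur_polynomials.
Variable n : nat.

(* A partition with at most n parts, padded with zeros, is a weakly decreasing
   function on 'I_n. *)
Definition is_partition (mu : {ffun 'I_n -> nat}) : bool :=
  [forall i : 'I_n, forall j : 'I_n, (i <= j)%N ==> (mu j <= mu i)%N].

Definition weight (mu : {ffun 'I_n -> nat}) : nat := (\sum_j mu j)%N.

(* The cells (i, j), j < mu_i, of the Young diagram of mu; for a partition the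
   maximum of the mu_i is mu_1, so the bound on the column index is harmless. *)
Definition cell (mu : {ffun 'I_n -> nat}) : finType :=
  {c : 'I_n * 'I_(\max_i mu i) | (c.2 < mu c.1)%N}.

Definition semistandard k (mu : {ffun 'I_n -> nat})
    (T : {ffun cell mu -> 'I_k}) : bool :=
  [forall c : cell mu, forall d : cell mu,
     (((val c).1 == (val d).1) && ((val c).2 <= (val d).2)%N
        ==> (T c <= T d)%N) &&
     (((val c).2 == (val d).2) && ((val c).1 < (val d).1)%N
        ==> (T c < T d)%N)].

Definition schur (R : realType) k (mu : {ffun 'I_n -> nat}) (v : 'I_k -> R) :
    R :=
  \sum_(T : {ffun cell mu -> 'I_k} | semistandard T) \prod_c v (T c).

End Schur_polynomials.

(* The process with N = n.+1.  The time t = 1, ..., N and the part index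
   j = 1, ..., N of the usual notation are t.-1 and j.-1 in 'I_n.+1. *)
Section Schur_process.
Variables (R : realType) (n : nat).

Definition config := {ffun 'I_n.+1 -> {ffun 'I_n.+1 -> nat}}.

Definition configs : set config :=
  [set w | forall t, is_partition (w t)].

Definition vertical_step (mu nu : {ffun 'I_n.+1 -> nat}) : bool :=
  [forall j, (mu j == nu j) || (mu j == (nu j).+1)].

(* Whenever the indicator of a vertical step is nonzero, the truncated
   difference of weights in the exponent is the true one. *)
Definition schur_weight (x y beta : R) (w : config) : R :=
  schur (w ord0) (fun _ : 'I_n.+1 => x) *
  (\prod_(m < n) ((- beta) ^+ (weight (w (inord m)) - weight (w (inord m.+1))) *
                  (vertical_step (w (inord m)) (w (inord m.+1)))%:R)) *
  schur (w ord_max) (fun _ : 'I_n.+1 => y).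

Definition schur_prob (x y beta : R) (E : set config) : R :=
  fine (\esum_(w in configs `&` E) (schur_weight x y beta w)%:E) /
  fine (\esum_(w in configs) (schur_weight x y beta w)%:E).

(* The number of j with mu^t_j + N - j >= a, for t = 1, ..., N. *)
Definition height (w : config) (a t : nat) : nat :=
  #|[pred j : 'I_n.+1 | (a <= w (inord t.-1) j + (n - j))%N]|.

End Schur_process.

Section Limit_shape.
Variable R : realType.
Implicit Types (x y beta : R) (h : R * R -> R) (p : R * R).

(* Principal argument of a nonzero complex number. *)
Definition Arg (z : R[i]) : R :=
  if 0 <= complex.Im z then acos (complex.Re z / normc z) else - acos (complex.Re z / normc z).

Definition cubic x y beta p : {poly R} :=
  let: (xi, tau) := p in
  (xi * x) *: 'X^3
  - (xi + beta * x * (xi + tau - 1) + (xi + 1) * x * y - 1) *: 'X^2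
  + (beta * (xi + tau + xi * x * y + tau * x * y - 2) + xi * y) *: 'X
  - (beta * y * (xi + tau - 1))%:P.

Definition domain : set (R * R) :=
  [set p | 0 <= p.1 /\ 0 <= p.2 <= 1].

Definition strip : set (R * R) :=
  [set p | 0 < p.1 /\ 0 < p.2 < 1].

Definition critical_point x y beta p (z : R[i]) : Prop :=
  0 < complex.Im z /\ root (map_poly (real_complex R) (cubic x y beta p)) z.

Definition liquid x y beta : set (R * R) :=
  [set p | strip p /\ exists z, critical_point x y beta p z].

Definition frozen_boundary x y beta : set (R * R) :=
  strip `&` (closure (liquid x y beta) `\` liquid x y beta).

Definition frozen x y beta : set (R * R) :=
  strip `\` closure (liquid x y beta).

Definition frozen_zone x y beta (Z : set (R * R)) : Prop :=
  exists2 p, frozen x y beta p &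
    Z = connected_component (frozen x y beta) p.

Definition double_root (P : {poly R}) (z : R) : Prop :=
  ('X - z%:P) ^+ 2 %| P.

Definition has_gradient h p (a b : R) : Prop :=
  is_derive p.1 1 (fun u => h (u, p.2)) a /\
  is_derive p.2 1 (fun v => h (p.1, v)) b.

(* At tau = 0 the integer part of tau N is not one of the times 1, ..., N;
   there h is determined by continuity. *)
Definition height_cvg x y beta h : Prop :=
  forall xi tau eps : R, 0 <= xi -> 0 < tau <= 1 -> 0 < eps ->
  (fun n => schur_prob x y beta
     [set w : config n |
        eps <= `| (height w (Num.truncn (xi * n.+1%:R))
                            (Num.truncn (tau * n.+1%:R)))%:R / n.+1%:R
                  - h (xi, tau) |]) @ \oo --> (0 : R).

Record limit_shape x y beta h : Prop := LimitShape {
  limit_shape_cvg : height_cvg x y beta h;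
  limit_shape_continuous : {within domain, continuous h};
  limit_shape_decreasing : forall p q, domain p -> domain q ->
    p.1 <= q.1 -> p.2 <= q.2 -> h q <= h p;
  limit_shape_differentiable : forall p,
    strip p -> ~ frozen_boundary x y beta p -> differentiable h p;
  limit_shape_liquid : forall p z, strip p -> critical_point x y beta p z ->
    has_gradient h p (- (Arg z / pi))
                     ((Arg (z - beta%:C) - Arg z) / pi);
  limit_shape_frozen : forall Z p z, frozen_zone x y beta Z ->
    frozen_boundary x y beta p -> closure Z p ->
    double_root (cubic x y beta p) z ->
    [/\ 0 < z -> forall q, Z q -> has_gradient h q 0 0,
        beta < z < 0 -> forall q, Z q -> has_gradient h q (-1) (-1)
      & z < beta -> forall q, Z q -> has_gradient h q (-1) 0] }.

Definition zoneII x y beta h (Z : set (R * R)) : Prop :=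
  frozen_zone x y beta Z /\ forall p, Z p -> has_gradient h p (-1) (-1).

(* The zone crosses the strip from its lower side tau = 0 to its upper side
   tau = 1, being connected and meeting every horizontal line in between.  It
   cannot fill the strip: h, a limit of normalized counts, is nonnegative. *)
Definition extends_through_strip (Z : set (R * R)) : Prop :=
  forall tau : R, 0 < tau < 1 -> exists2 xi : R, 0 < xi & Z (xi, tau).

End Limit_shape.

(* Main.v *)
(* Write b = - beta and c = xi + tau - 1.  For 0 <= s < b the cubic at z = - s
   has the sign of c - phi(s), where
     phi(s) = (1 - tau) s / (b - s) + (1 - x y) s / ((1 + x s) (s + y)).
   For large b the function phi rises from 0 to a hump near s = sqrt (y / x),
   falls below a level eps independent of b and tau, and blows up at s = b.
   At the points with c = eps, for all 0 < tau < 1, the cubic thus has three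
   distinct real roots in (beta, 0), and this segment lies in one frozen zone.
   Increasing xi from one of its points until c reaches the top of the hump, one
   stays in that zone and arrives at a double root in (beta, 0).  As (xi, tau)
   depends continuously on the critical point, even up to real critical points,
   this is a point of the frozen boundary, so that the gradient in the zone is
   (-1, -1). *)
Require Import Defs.
From mathcomp Require Import all_boot all_order all_algebra.
From mathcomp Require Import all_classical all_reals all_analysis.
From mathcomp Require Import complex polyrcf ring lra.

Import Order.TTheory GRing.Theory Num.Theory.
Import numFieldNormedType.Exports.
Local Open Scope ring_scope.
Local Open Scope classical_set_scope.

(** * The cubic at negative arguments and its factorization at critical points *)

Section Cubic.
Set Implicit Arguments.
Unset Strict Implicit.
Variables (R : realType) (x y b : R).
Implicit Types (s u : R) (p : R * R).

(** Division by [(1 + x * s) * (s + y) * (b - s)] turns the right-hand side into c - phi(s). *)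
Lemma horner_cubic p s : (cubic x y (- b) p).[- s] =
  (1 + x * s) * (s + y) * ((p.1 + p.2 - 1) * (b - s) - (1 - p.2) * s)
  - (1 - x * y) * s * (b - s).
Proof. by case: p => xi tau /=; rewrite /cubic !hornerE /=; ring. Qed.

Lemma size_cubic p : (size (cubic x y (- b) p) <= 4)%N.
Proof.
apply/leq_sizeP => -[|[|[|[|j]]]] // _; case: p => xi tau.
rewrite /cubic !(coefD, coefN, coefZ, coefXn, coefX, coefC) /=.
by rewrite !(mulr0, subr0, addr0).
Qed.

(* Clearing denominators in the real and imaginary parts of the cubic at
   [z = - s + i e] gives a linear system for [(xi, tau)]; this is its solution
   in terms of [u = e ^+ 2], which remains continuous at [u = 0]. *)
Definition critical_locus s u : R * R :=
  let d := ((1 + x * s) ^+ 2 + x ^+ 2 * u) * ((s + y) ^+ 2 + u) in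
  ((1 - x * y) *
     (b * (x * (s ^+ 2 + u) - y) + 2 * y * s + (s ^+ 2 + u) * (1 + x * y)) / d,
   1 - (1 - x * y) * (x * (s ^+ 2 + u) - y) * ((b - s) ^+ 2 + u) / (b * d)).

Hypotheses (x_gt0 : 0 < x) (y_gt0 : 0 < y) (b_gt0 : 0 < b).

(** The quadratic factor has roots [- s] plus or minus i sqrt(u). The leading and constant
    coefficients dictate [l] and [m]; the two middle ones then agree by the choice of (xi, tau). *)
Lemma critical_locus_factor s u : 0 < s -> 0 <= u ->
  exists l m : R, cubic x y (- b) (critical_locus s u) =
    ('X ^+ 2 + (2 * s) *: 'X + (s ^+ 2 + u)%:P) * (l *: 'X + m%:P).
Proof.
move=> s_gt0 u_ge0.
have d1 : (1 + x * s) ^+ 2 + x ^+ 2 * u != 0.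
  rewrite gt_eqF // ltr_pwDl //; last by rewrite mulr_ge0 ?sqr_ge0.
  by rewrite exprn_gt0 // addr_gt0 ?mulr_gt0.
have d2 : (s + y) ^+ 2 + u != 0.
  by rewrite gt_eqF // ltr_pwDl ?exprn_gt0 ?addr_gt0.
have q0 : s ^+ 2 + u != 0 by rewrite gt_eqF // ltr_pwDl ?exprn_gt0.
case def_p: (critical_locus s u) => [xi tau].
move: def_p; rewrite /critical_locus => -[def_xi def_tau].
exists (xi * x), (b * y * (xi + tau - 1) / (s ^+ 2 + u)).
rewrite /cubic; set B := xi + _ + _ - 1; set C := (_ + xi * y).
set m := (b * y * _ / _).
have -> : B = - (m + 2 * s * (xi * x)).
  rewrite /B /m -def_xi -def_tau; field.
  by rewrite d1 d2 q0 gt_eqF.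
have -> : C = xi * x * (s ^+ 2 + u) + 2 * s * m.
  rewrite /C /m -def_xi -def_tau; field.
  by rewrite d1 d2 q0 gt_eqF.
have -> : - b * y * (xi + tau - 1) = - (m * (s ^+ 2 + u)).
  by rewrite /m; field.
rewrite -!mul_polyC !(polyCN, polyCD, polyCM); ring.
Qed.

Lemma critical_locus_root s e : 0 < s ->
  root (map_poly (real_complex R) (cubic x y (- b) (critical_locus s (e ^+ 2))))
    (Complex (- s) e).
Proof.
move=> s_gt0; have [l [m ->]] := critical_locus_factor s_gt0 (sqr_ge0 e).
rewrite rmorphM rootM; apply/orP; left; apply/rootP.
rewrite 2!rmorphD /= map_polyC map_polyZ rmorphXn /= map_polyX !hornerE /=.
apply/eqP; rewrite expr2 eq_complex /=.
by apply/andP; split; apply/eqP; ring.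
Qed.

Lemma critical_locus_double_root s : 0 < s ->
  double_root (cubic x y (- b) (critical_locus s 0)) (- s).
Proof.
move=> s_gt0; have [l [m ->]] := critical_locus_factor s_gt0 (lexx 0).
apply: dvdp_mulr; rewrite [X in _ %| X](_ : _ = ('X - (- s)%:P) ^+ 2) //.
rewrite -mul_polyC !(polyCN, polyCD, polyCM, polyC_exp, polyC0); ring.
Qed.

(** * Exclusion of nonreal roots *)

Hypothesis xy_lt1 : x * y < 1.

Lemma cubic_neq0 p : cubic x y (- b) p != 0.
Proof.
(* At z = y, that is s = - y, the factor [s + y] vanishes and only [(1 - x * y) * y * (b + y)] is
   left. *)
apply/eqP => /(congr1 (horner^~ y)); rewrite horner0 -{2}[y]opprK horner_cubic.
move=> P0; have : 0 < (1 - x * y) * y * (b + y).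
  by rewrite mulr_gt0 ?addr_gt0 // mulr_gt0 // subr_gt0.
nra.
Qed.

(* The third root, being the zero of a real linear factor, is real too. *)
Lemma critical_locus_not_critical s z : 0 < s ->
  ~ critical_point x y (- b) (critical_locus s 0) z.
Proof.
move=> s_gt0 [z_im]; have [l [m Ecubic]] := critical_locus_factor s_gt0 (lexx 0).
have := cubic_neq0 (critical_locus s 0).
rewrite Ecubic mulf_eq0 negb_or => /andP[_ lm0].
rewrite rmorphM rootM => /orP[] /rootP.
  rewrite 2!rmorphD /= map_polyC map_polyZ rmorphXn /= map_polyX !hornerE /=.
  case: z z_im => a c /= c0 /eqP; rewrite expr2 eq_complex /= => /andP[].
  move=> /eqP re0 /eqP im0.
  have ac : c * (a + s) = 0 by lra.
  have /eqP as0 : a + s == 0 by move/eqP: ac; rewrite mulf_eq0 gt_eqF.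
  have : 0 < c ^+ 2 by rewrite exprn_gt0.
  nra.
rewrite rmorphD /= map_polyC map_polyZ /= map_polyX !hornerE /=.
case: z z_im => a c /= c0 /eqP; rewrite eq_complex /= => /andP[].
move=> /eqP re0 /eqP im0.
have lc : l * c = 0 by lra.
have /eqP l0 : l == 0.
  by move/eqP: lc; rewrite mulf_eq0 (gt_eqF c0) orbF.
have m0 : m = 0 by nra.
by move/eqP: lm0; apply; rewrite l0 m0 scale0r add0r.
Qed.

(* With [0 < s < t < b], these signs separate three roots in [(- b, 0)]. *)
Definition alternating s t : set (R * R) :=
  [set p | [/\ (cubic x y (- b) p).[- b] < 0, 0 < (cubic x y (- b) p).[- t],
     (cubic x y (- b) p).[- s] < 0 & 0 < (cubic x y (- b) p).[0] ]].

(** A nonreal [z] would be a fourth root besides the three real ones, too many for a nonzero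
    polynomial of degree at most 3. *)
Lemma alternating_not_critical s t p z : 0 < s < t -> t < b ->
  alternating s t p -> ~ critical_point x y (- b) p z.
Proof.
move=> /andP[s0 st] tb [Pb Pt Ps P0] [z_im zroot].
have [||r1 /[!in_itv]/= r1i r1r] := @poly_ivtoo _ (cubic x y (- b) p) (- b) (- t).
- by lra.
- by rewrite nmulr_rlt0.
have [||r2 /[!in_itv]/= r2i r2r] := @poly_ivtoo _ (cubic x y (- b) p) (- t) (- s).
- by lra.
- by rewrite pmulr_rlt0.
have [||r3 /[!in_itv]/= r3i r3r] := @poly_ivtoo _ (cubic x y (- b) p) (- s) 0.
- by lra.
- by rewrite nmulr_rlt0.
have zNreal r : (z == real_complex R r) = false.
  by apply: contraTF z_im => /eqP ->; rewrite /= ltxx.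
have := @max_poly_roots _ (map_poly (real_complex R) (cubic x y (- b) p))
  [:: z; real_complex R r1; real_complex R r2; real_complex R r3].
rewrite map_poly_eq0 cubic_neq0 size_map_poly ltnNge size_cubic /=.
rewrite zroot !fmorph_root r1r r2r r3r !inE !zNreal !(inj_eq (fmorph_inj _)) /=.
have -> : (r1 == r2) = false by apply/negbTE; rewrite lt_eqF; lra.
have -> : (r1 == r3) = false by apply/negbTE; rewrite lt_eqF; lra.
have -> : (r2 == r3) = false by apply/negbTE; rewrite lt_eqF; lra.
by move=> /(_ isT isT isT).
Qed.

Lemma continuous_horner_cubic s :
  continuous (fun p : R * R => (cubic x y (- b) p).[- s]).
Proof.
move=> p; pose c := (1 + x * s) * (s + y).
rewrite (_ : (fun p => _) = (fun p : R * R => c * (b - s) * p.1 + c * b * p.2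
    + (- c * b - (1 - x * y) * s * (b - s)))).
  apply: cvgD; last exact: cvg_cst.
  by apply: cvgD; (apply: cvgM; first exact: cvg_cst);
    [exact: cvg_fst | exact: cvg_snd].
by apply/funext => q; rewrite horner_cubic /c; ring.
Qed.

Lemma open_alternating s t : open (alternating s t).
Proof.
rewrite (_ : alternating s t =
  (fun p => (cubic x y (- b) p).[- b]) @^-1` [set r | r < 0] `&`
  (fun p => (cubic x y (- b) p).[- t]) @^-1` [set r | r > 0] `&`
  (fun p => (cubic x y (- b) p).[- s]) @^-1` [set r | r < 0] `&`
  (fun p => (cubic x y (- b) p).[- 0]) @^-1` [set r | r > 0]).
  by do !apply: openI; apply: open_comp; do ?[exact: open_lt | exact: open_gt];
    move=> p _; apply: continuous_horner_cubic.
rewrite oppr0; apply/seteqP; split => [p [? ? ? ?]|p [[[? ?] ?] ?]] //.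
Qed.

(** The sign conditions are open, so a whole neighbourhood of [p] is free of nonreal roots; this
    keeps [p] off the closure of the liquid region. *)
Lemma alternating_frozen s t p : 0 < s < t -> t < b ->
  strip p -> alternating s t p -> frozen x y (- b) p.
Proof.
move=> st tb p_strip p_alt; split=> // /(_ (alternating s t)).
have /[swap]/[apply] : nbhs p (alternating s t).
  by apply: open_nbhs_nbhs; split=> //; exact: open_alternating.
move=> [q [[_ [z zcrit]] q_alt]].
exact: (alternating_not_critical st tb q_alt zcrit).
Qed.

Lemma critical_locus_cvg s : 0 < s ->
  critical_locus s u @[u --> (0 : R)] --> critical_locus s 0.
Proof.
move=> s_gt0.
have affine (f : R -> R) (k l : R) : f =1 (fun u => k * u + l) ->
    f u @[u --> (0 : R)] --> f 0.
  move=> /funext ->; apply: cvgD; last exact: cvg_cst.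
  by apply: cvgM; [exact: cvg_cst | exact: cvg_id].
have d_cvg : (((1 + x * s) ^+ 2 + x ^+ 2 * u) * ((s + y) ^+ 2 + u))
    @[u --> (0 : R)] --> ((1 + x * s) ^+ 2 + x ^+ 2 * 0) * ((s + y) ^+ 2 + 0).
  apply: cvgM.
    by apply: (affine _ (x ^+ 2) ((1 + x * s) ^+ 2)) => u; ring.
  by apply: cvgD; [exact: cvg_cst | exact: cvg_id].
have d_neq0 : ((1 + x * s) ^+ 2 + x ^+ 2 * 0) * ((s + y) ^+ 2 + 0) != 0.
  rewrite mulr0 !addr0 mulf_neq0 // expf_neq0 // gt_eqF //;
    by rewrite addr_gt0 ?mulr_gt0.
rewrite /critical_locus /=; apply: (@cvg_pair _ _ _ _ (nbhs _) (nbhs _)).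
  apply: cvgM; last exact: (cvgV d_neq0 d_cvg).
  apply: (affine _ ((1 - x * y) * (b * x + 1 + x * y)) ((1 - x * y) *
    (b * (x * s ^+ 2 - y) + 2 * y * s + s ^+ 2 * (1 + x * y)))) => u; ring.
apply: cvgB; first exact: cvg_cst.
apply: cvgM; last first.
  apply: cvgV; first by rewrite mulf_neq0 // gt_eqF.
  by apply: cvgM => //; exact: cvg_cst.
apply: cvgM.
  apply: (affine _ ((1 - x * y) * x) ((1 - x * y) * (x * s ^+ 2 - y))) => u; ring.
by apply: cvgD; [exact: cvg_cst | exact: cvg_id].
Qed.

Lemma open_strip : open (@strip R).
Proof.
rewrite (_ : @strip R = (fst @^-1` [set r | r > 0]) `&`
   (snd @^-1` [set r | r > 0]) `&` (snd @^-1` [set r | r < 1])).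
  by do !apply: openI; apply: open_comp; do ?[exact: open_lt | exact: open_gt];
    move=> p _; first [exact: cvg_fst | exact: cvg_snd].
by apply/seteqP; split=> [p [? /andP[? ?]]|p [[? ?] ?]] //; split=> //; apply/andP.
Qed.

(** Moving the double root [- s] to - s + i sqrt(u) gives liquid points [critical_locus s u], which
    tend to this one as [u] decreases to 0. *)
Lemma critical_locus_frozen_boundary s : 0 < s -> strip (critical_locus s 0) ->
  frozen_boundary x y (- b) (critical_locus s 0).
Proof.
move=> s_gt0 p_strip; split=> //; split; last first.
  by move=> [_ [z]]; exact: critical_locus_not_critical.
move=> B pB.
have nearB : nbhs (critical_locus s 0) (@strip R `&` B).
  by apply: filterI => //; apply: open_nbhs_nbhs; split=> //; exact: open_strip.
have {}nearB : \forall u \near (0 : R)^'+,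
    (@strip R `&` B) (critical_locus s u).
  exact: (cvg_at_right_filter (critical_locus_cvg s_gt0)) nearB.
have [u [[u_strip Bu] u_gt0]] :
    exists u, (@strip R `&` B) (critical_locus s u) /\ 0 < u.
  apply: (@filter_ex _ (nbhs (0 : R)^'+)); apply: filterI; first exact: nearB.
  exact: nbhs_right_gt.
exists (critical_locus s u); split=> //; split=> //.
exists (Complex (- s) (Num.sqrt u)); split; first by rewrite sqrtr_gt0.
by rewrite -{1}[u]sqr_sqrtr ?ltW //; exact: critical_locus_root.
Qed.

(** For [0 <= s < b] the slope in [xi] is positive, which decides the sign at [- s] on either side
    of a zero. *)
Lemma horner_cubic_shift s (xi xi' tau : R) :
  (cubic x y (- b) (xi, tau)).[- s] = (cubic x y (- b) (xi', tau)).[- s]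
    + (1 + x * s) * (s + y) * (b - s) * (xi - xi').
Proof. by rewrite !horner_cubic /=; ring. Qed.

Lemma horner_critical_locus s : 0 < s ->
  (cubic x y (- b) (critical_locus s 0)).[- s] = 0.
Proof.
move=> /critical_locus_double_root; rewrite /double_root expr2 => dvd_sq.
by apply/rootP; rewrite root_factor_theorem (dvdp_trans _ dvd_sq) ?dvdp_mulIl.
Qed.

(** Beyond s = sqrt(y / x) the quantity 1 - tau is positive. It stays below 1 because 1 - x y < 1,
    (b - s)^2 <= b^2 and (1 + x s)^2 (s + y)^2 >= y^2. *)
Lemma critical_locus_strip s : 0 < s < b -> 0 < x * s ^+ 2 - y ->
  (x * s ^+ 2 - y) * b <= y ^+ 2 -> strip (critical_locus s 0).
Proof.
move=> /andP[s_gt0 lt_sb] xsq_gt xsq_le.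
have xs_gt0 : 0 < x * s by exact: mulr_gt0.
have d_ge : y ^+ 2 <= (1 + x * s) ^+ 2 * (s + y) ^+ 2.
  rewrite -[leLHS]mul1r; apply: ler_pM; rewrite ?ler01 ?sqr_ge0 //.
    by rewrite expr_ge1 ?lerDl ?ltW // addr_gt0.
  by rewrite ler_pXn2r ?nnegrE ?lerDr ?addr_ge0 // ltW.
have d_gt0 : 0 < (1 + x * s) ^+ 2 * (s + y) ^+ 2.
  by rewrite (lt_le_trans _ d_ge) // exprn_gt0.
rewrite /critical_locus !mulr0 !addr0; move: d_ge d_gt0.
move: ((1 + x * s) ^+ 2 * (s + y) ^+ 2) => d d_ge d_gt0.
have xy_gt0 : 0 < 1 - x * y by rewrite subr_gt0.
have bs_gt0 : 0 < b - s by rewrite subr_gt0.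
split=> /=.
  apply: divr_gt0 => //; apply: mulr_gt0 => //; apply: addr_gt0.
    by apply: addr_gt0; rewrite !mulr_gt0.
  by rewrite mulr_gt0 ?exprn_gt0 // addr_gt0 // mulr_gt0.
have n_gt0 : 0 < (1 - x * y) * (x * s ^+ 2 - y) * (b - s) ^+ 2.
  by apply: mulr_gt0; [exact: mulr_gt0 | exact: exprn_gt0].
rewrite subr_gt0 gtrBl divr_gt0 ?andbT ?mulr_gt0 //.
rewrite ltr_pdivrMr ?mul1r ?mulr_gt0 //.
apply: (@lt_le_trans _ _ ((x * s ^+ 2 - y) * (b - s) ^+ 2)).
  rewrite -mulrA gtr_pMl; first by rewrite gtrBl mulr_gt0.
  by apply: mulr_gt0 => //; exact: exprn_gt0.
apply: (@le_trans _ _ ((x * s ^+ 2 - y) * b ^+ 2)).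
  by rewrite ler_pM2l // ler_pXn2r ?nnegrE ?gerBl // ltW.
by rewrite (expr2 b) mulrA [leRHS]mulrC ler_pM2r // (le_trans xsq_le).
Qed.

(** * A frozen zone that crosses the strip *)

Section Crossing.
Variables (s t eps : R).
Hypotheses (s_gt0 : 0 < s) (lt_st : s < t) (lt_tb : t < b) (eps_gt0 : 0 < eps).
(** For 0 < tau < 1 these make each summand of phi(t) less than [eps / 2], so that phi dips below
    the level [eps] at [t]. *)
Hypotheses (le_t_eps : t <= eps / 2 * (b - t)) (lt2_t : 2 < x * eps * t).

(** From the level [eps] upwards the signs at [- b], [- t] and 0 are automatic; only the one at
    [- s] depends on the hump. *)
Lemma alternating_level p : 0 < p.2 < 1 -> eps <= p.1 + p.2 - 1 ->
  (cubic x y (- b) p).[- s] < 0 -> alternating s t p.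
Proof.
move=> /andP[tau_gt0 tau_lt1] le_eps Ps.
have t_gt0 : 0 < t by exact: lt_trans lt_st.
have c_gt0 : 0 < p.1 + p.2 - 1 by exact: lt_le_trans le_eps.
have bt_gt0 : 0 < b - t by rewrite subr_gt0.
split=> //.
- rewrite horner_cubic subrr !mulr0 subr0 sub0r mulrN oppr_lt0.
  by rewrite !mulr_gt0 ?subr_gt0 // addr_gt0 // mulr_gt0.
- rewrite horner_cubic subr_gt0.
  set c := p.1 + p.2 - 1 in le_eps c_gt0 *.
  have c_ge : eps / 2 * (b - t) <= c * (b - t) - (1 - p.2) * t.
    have h1 : eps * (b - t) <= c * (b - t) by rewrite ler_pM2r.
    have h2 : 0 < p.2 * t by rewrite mulr_gt0.
    by have := le_t_eps; lra.
  have d_ge : x * t * t <= (1 + x * t) * (t + y).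
    have xty_gt0 : 0 < x * t * y by rewrite !mulr_gt0.
    have y0 := y_gt0; lra.
  apply: (@lt_le_trans _ _ (x * t * t * (eps / 2 * (b - t)))); last first.
    by apply: ler_pM => //; rewrite !mulr_ge0 ?invr_ge0 // ltW.
  apply: (@lt_le_trans _ _ (1 * t * (b - t))).
    by rewrite !ltr_pM2r // gtrBl mulr_gt0.
  rewrite mul1r (_ : x * t * t * _ = (x * eps * t) / 2 * (t * (b - t)));
    last by field.
  by rewrite ler_peMl ?mulr_ge0 ?ltW //; have := lt2_t; lra.
- have := horner_cubic p 0; rewrite oppr0 => ->.
  by rewrite !(mulr0, mul0r, subr0, add0r, addr0, mul1r) mulr_gt0 // mulr_gt0.
Qed.

(** The second summand of phi(s) alone exceeds [eps], whatever tau is. *)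
Hypothesis lt_eps : eps * ((1 + x * s) * (s + y)) < (1 - x * y) * s.

Let horner_level_lt0 (tau : R) : 0 < tau < 1 ->
  (cubic x y (- b) (1 + eps - tau, tau)).[- s] < 0.
Proof.
move=> /andP[tau_gt0 tau_lt1]; rewrite horner_cubic /=.
have -> : 1 + eps - tau + tau - 1 = eps by ring.
have := lt_eps; set d := (1 + x * s) * (s + y) => ed.
have d_gt0 : 0 < d by rewrite mulr_gt0 // addr_gt0 // mulr_gt0.
have h1 : 0 < ((1 - x * y) * s - eps * d) * (b - s).
  by rewrite mulr_gt0 ?subr_gt0 // (lt_trans lt_st).
have h2 : 0 < d * ((1 - tau) * s) by rewrite mulr_gt0 // mulr_gt0 // subr_gt0.
nra.
Qed.

Hypothesis p_strip : strip (critical_locus s 0).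

Lemma frozen_zone_crossing :
  exists2 Z, frozen_zone x y (- b) Z &
    closure Z (critical_locus s 0) /\ extends_through_strip Z.
Proof.
have Ps := horner_critical_locus s_gt0.
have eps0 := eps_gt0.
case def_p : (critical_locus s 0) p_strip Ps =>
  [xi0 tau0] [/= xi0_gt0 tau0_01] Ps.
have K_gt0 : 0 < (1 + x * s) * (s + y) * (b - s).
  rewrite !mulr_gt0 ?subr_gt0 ?(lt_trans lt_st) //.
    by rewrite addr_gt0 // mulr_gt0.
  by rewrite addr_gt0.
(* The cubic at [- s] is negative on the level c = eps and zero at [xi0]; as it increases with xi,
   the level lies to the left. *)
have lt_xi0 : 1 + eps - tau0 < xi0.
  have := horner_level_lt0 tau0_01.
  by rewrite (horner_cubic_shift _ _ xi0) Ps add0r pmulr_rlt0 // subr_lt0.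
have st : 0 < s < t by rewrite s_gt0.
have path_frozen (tau : R) : 0 < tau < 1 ->
    frozen x y (- b) (1 + eps - tau, tau).
  move=> tau01; apply: (alternating_frozen st lt_tb).
    by split=> //=; lra.
  by apply: alternating_level => //=; [lra | exact: horner_level_lt0].
have seg_frozen (xi : R) : 1 + eps - tau0 <= xi < xi0 ->
    frozen x y (- b) (xi, tau0).
  move=> xi_itv; apply: (alternating_frozen st lt_tb).
    by split=> //=; lra.
  apply: alternating_level => //=; first by lra.
  by rewrite (horner_cubic_shift _ _ xi0) Ps add0r pmulr_rlt0 // subr_lt0; lra.
(* [p1] is where the line c = eps meets the horizontal line through the critical point, so its
   component contains both segments. *)
pose p1 := (1 + eps - tau0, tau0); pose F := frozen x y (- b).
have path_comp (tau : R) : 0 < tau < 1 ->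
    connected_component F p1 (1 + eps - tau, tau).
  move=> tau01.
  apply: (@connected_component_max _ F
    ((fun v => (1 + eps - v, v)) @` [set v | 0 < v < 1])).
  - by exists tau0.
  - by move=> _ [v v01 <-]; exact: path_frozen.
  - apply: connected_continuous_connected.
      by apply/connected_intervalP => v w /= v_itv w_itv z vzw; lra.
    apply: continuous_subspaceT => v.
    apply: (@cvg_pair _ _ _ _ (nbhs _) (nbhs _)); last exact: cvg_id.
    by apply: cvgB; [exact: cvg_cst | exact: cvg_id].
  - by exists tau.
have pair_cvg (v : R) : (w, tau0) @[w --> v] --> (v, tau0).
  by apply: (@cvg_pair _ _ _ _ (nbhs _) (nbhs _)); [exact: cvg_id | exact: cvg_cst].
have seg_comp (xi : R) : 1 + eps - tau0 <= xi < xi0 ->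
    connected_component F p1 (xi, tau0).
  move=> xi_itv.
  apply: (@connected_component_max _ F
    ((fun v => (v, tau0)) @` [set v | 1 + eps - tau0 <= v < xi0])).
  - by exists (1 + eps - tau0) => //=; rewrite lexx.
  - by move=> _ [v v_itv <-]; exact: seg_frozen.
  - apply: connected_continuous_connected.
      by apply/connected_intervalP => v w /= v_itv w_itv z vzw; lra.
    by apply: continuous_subspaceT => v; exact: pair_cvg.
  - by exists xi.
exists (connected_component F p1).
  by exists p1 => //; exact: path_frozen.
split=> [B pB|tau tau01]; last first.
  by exists (1 + eps - tau); [lra | exact: path_comp].
(* The half-open horizontal segment accumulates at its missing right end. *)
have nearB : \forall w \near xi0^'-, B (w, tau0).
  exact: (cvg_at_left_filter (pair_cvg xi0)) pB.
have [w [[Bw w_lt] w_ge]] :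
    exists w, (B (w, tau0) /\ w < xi0) /\ 1 + eps - tau0 <= w.
  apply: (@filter_ex _ (nbhs xi0^'-)); apply: filterI; last exact: nbhs_left_ge.
  by apply: filterI; [exact: nearB | exact: nbhs_left_lt].
by exists (w, tau0); split=> //; apply: seg_comp; apply/andP.
Qed.

End Crossing.

End Cubic.

(** * Choice of the constants and identification of the gradient *)

Theorem lemma5p6 (R : realType) (x y : R) (hx : 0 < x) (hy : 0 < y)
    (hxy : x * y < 1) :
  exists2 beta0 : R, beta0 < 0 &
    forall beta : R, beta < beta0 ->
    forall h : R * R -> R, limit_shape x y beta h ->
    exists2 Z : set (R * R), zoneII x y beta h Z & extends_through_strip Z.
Proof.
(* The second summand of phi is maximal at [s1]. *)
pose s1 := Num.sqrt (y / x).
have s1_gt0 : 0 < s1 by rewrite sqrtr_gt0 divr_gt0.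
have s1_sq : x * s1 ^+ 2 = y.
  by rewrite sqr_sqrtr ?divr_ge0 ?ltW // mulrCA divff ?mulr1 // gt_eqF.
have xs1_gt0 : 0 < x * (s1 + 1) by rewrite mulr_gt0 // addr_gt0.
(* [M] bounds [(1 + x * s) * (s + y)] for all 0 <= s <= s1 + 1. The final [s] depends on [b], but
   [eps] thus does not. *)
pose M := (1 + x * (s1 + 1)) * (s1 + 1 + y).
have M_gt0 : 0 < M by rewrite mulr_gt0 //; lra.
have xy_gt0 : 0 < 1 - x * y by rewrite subr_gt0.
pose eps := (1 - x * y) * s1 / 2 / M.
have eps_gt0 : 0 < eps by rewrite !divr_gt0 // mulr_gt0.
(* The part [s1 + 1] puts [t] beyond [s], and [3 / (x * eps)] ensures [2 < x * eps * t]. *)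
pose t := s1 + 1 + 3 / (x * eps).
have xeps_gt0 : 0 < x * eps by rewrite mulr_gt0.
have t_gt : s1 + 1 < t by rewrite ltrDl divr_gt0.
have lt2_t : 2 < x * eps * t.
  rewrite /t mulrDr [_ * (3 / _)]mulrC divfK ?gt_eqF //.
  have : 0 < x * eps * (s1 + 1) by rewrite mulr_gt0 // addr_gt0.
  lra.
pose c := x * (2 * s1 + 1).
have c_gt0 : 0 < c by rewrite mulr_gt0 //; lra.
have t2_gt0 : 0 < t * 2 / eps by rewrite divr_gt0 // mulr_gt0 //; lra.
have y2_gt0 : 0 < y ^+ 2 / c by rewrite divr_gt0 // exprn_gt0.
(* The first two summands give [t <= eps / 2 * (b - t)], the last one [delta < 1]. *)
exists (- (t + t * 2 / eps + y ^+ 2 / c)); first by lra.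
move=> beta; rewrite -[beta]opprK ltrN2; move: (- beta) => b lt_b h hlim.
have b_gt0 : 0 < b by lra.
(* As [delta < 1], [c * delta] bounds [x * s ^+ 2 - y] for [s = s1 + delta]: far enough past [s1]
   for tau < 1, close enough for tau > 0. *)
have [delta [delta_gt0 delta_lt1 deltaE]] :
    exists delta, [/\ 0 < delta, delta < 1 & y ^+ 2 = c * delta * b].
  exists (y ^+ 2 / c / b); split; first by rewrite divr_gt0.
    by rewrite ltr_pdivrMr // mul1r; lra.
  by field; rewrite !gt_eqF.
pose s := s1 + delta.
have s_gt0 : 0 < s by rewrite addr_gt0.
have lt_st : s < t by rewrite /s; lra.
have lt_tb : t < b by lra.
have lt_eps : eps * ((1 + x * s) * (s + y)) < (1 - x * y) * s.
  apply: (@le_lt_trans _ _ (eps * M)).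
    rewrite ler_pM2l //; apply: ler_pM; rewrite /s; nra.
  rewrite /eps divfK ?gt_eqF // /s; nra.
have le_t_eps : t <= eps / 2 * (b - t).
  have : t * 2 / eps <= b - t by lra.
  by rewrite ler_pdivrMr //; lra.
have xsqE : x * s ^+ 2 - y = x * delta * (2 * s1 + delta).
  by rewrite -[in LHS]s1_sq /s; ring.
have xsq_gt : 0 < x * s ^+ 2 - y.
  by rewrite xsqE !mulr_gt0 // addr_gt0 // mulr_gt0.
have xsq_le : (x * s ^+ 2 - y) * b <= y ^+ 2.
  rewrite deltaE ler_pM2r // xsqE /c mulrAC ler_pM2r // ler_pM2l //; lra.
have p_strip : strip (critical_locus x y b s 0).
  by apply: critical_locus_strip => //; rewrite s_gt0 (lt_trans lt_st).
have [Z Zfrozen [Zp Zext]] := frozen_zone_crossing hx hy b_gt0 hxy s_gt0 lt_st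
  lt_tb eps_gt0 le_t_eps lt2_t lt_eps p_strip.
exists Z => //; split=> //.
(* The double root [- s] lies between beta and 0, which selects the middle clause. *)
have [_ + _] := limit_shape_frozen hlim Zfrozen
  (critical_locus_frozen_boundary hx hy b_gt0 hxy s_gt0 p_strip)
  Zp (critical_locus_double_root hx hy b_gt0 s_gt0).
by apply; lra.
Qed.
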